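(* Let $\mathcal{T}$ be an associative conformal algebra, $\mathcal{U}$ a conformal $\mathcal{T}$-bimodule, $H$ a Hochschild $2$-cocycle of $\mathcal{T}$ with coefficients in $\mathcal{U}$, and $R:\mathcal{U}\to\mathcal{T}$ a conformal $H$-twisted Rota-Baxter operator. Let $R_t=R+tR_1$ be a linear deformation of $R$. Then $R_1$ is a $1$-cocycle in the cohomology of $R$, and the cohomology class of $R_1$ depends only on the equivalence class of the linear deformation $R_t$ (that is, if $R+tR_1$ and $R+tR'_1$ are equivalent linear deformations of $R$, then $R_1$ and $R'_1$ have the same cohomology class).
   Context: Everything is over $\mathbb{C}$. An associative conformal algebra is a $\mathbb{C}[\partial]$-module $\mathcal{T}$ with a $\lambda$-product $\mathcal{T}\otimes\mathcal{T}\to\mathcal{T}[\lambda]$, $p\otimes q\mapsto p_\lambda q$, that is conformally sesquilinear ($(\partial p)_\lambda q=-\lambda\,p_\lambda q$, $p_\lambda(\partial q)=(\partial+\lambda)(p_\lambda q)$) and satisfies $(p_\lambda q)_{\lambda+\mu}r=p_\lambda(q_\mu r)$. A conformal $\mathcal{T}$-bimodule is a $\mathbb{C}[\partial]$-module $\mathcal{U}$ with conformally sesquilinear maps $\mathcal{T}\otimes\mathcal{U}\to\mathcal{U}[\lambda]$, $(p,u)\mapsto p_\lambda u$, and $\mathcal{U}\otimes\mathcal{T}\to\mathcal{U}[\lambda]$, $(u,p)\mapsto u_\lambda p$, with $(p_\lambda u)_{\lambda+\mu}q=p_\lambda(u_\mu q)$, $(u_\lambda p)_{\lambda+\mu}q=u_\lambda(p_\mu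 q)$, $(p_\lambda q)_{\lambda+\mu}u=p_\lambda(q_\mu u)$. A Hochschild $2$-cocycle is a conformally sesquilinear map $H_\lambda:\mathcal{T}\otimes\mathcal{T}\to\mathcal{U}[\lambda]$ with ${p_1}_{\lambda_1}H_{\lambda_2}(p_2,p_3)-H_{\lambda_1+\lambda_2}({p_1}_{\lambda_1}p_2,p_3)+H_{\lambda_1}(p_1,{p_2}_{\lambda_2}p_3)-H_{\lambda_1}(p_1,p_2)_{\lambda_1+\lambda_2}p_3=0$. $\mathbb{C}[\partial]$-linear maps are extended coefficientwise to polynomials in $\lambda$. A conformal $H$-twisted Rota-Baxter operator is a $\mathbb{C}[\partial]$-linear map $R:\mathcal{U}\to\mathcal{T}$ with $R(u)_\lambda R(v)=R\big(u_\lambda R(v)+R(u)_\lambda v+H_\lambda(R(u),R(v))\big)$ for all $u,v\in\mathcal{U}$. If $x_\mu y=\sum_n\mu^nc_n$, then $x_{-\partial-\lambda}y=\sum_n(-\partial-\lambda)^nc_n$. Throughout, $\lambda$ is a free parameter. Low-degree cohomology of $R$: a $1$-cocycle is a $\mathbb{C}[\partial]$-linear map $g\in\mathrm{Hom}(\mathcal{U},\mathcal{T})$ with $d_R(g)=0$, which means that for all $u,v\in\mathcal{U}$ $$R(u)_\lambda g(v)+g(u)_\lambda R(v)=R\big(u_\lambda g(v)+g(u)_\lambda v+H_\lambda(R(u),g(v))+H_\lambda(g(u),R(v))\big)+g\big(u_\lambda R(v)+R(u)_\lambda v+H_\lambda(R(u),R(v))\big).$$ The $1$-coboundaries are the $d_R(p)$,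 $p\in\mathcal{T}$, where $d_R(p)$ is given, with the parameter $\lambda$, by $$d_R(p)_\lambda(u)=R\big(p_\lambda u-u_{-\partial-\lambda}p+H_\lambda(p,R(u))-H_\lambda(R(u),p)\big)-\big(p_\lambda R(u)-R(u)_{-\partial-\lambda}p\big).$$ Two $1$-cocycles $g,g'$ have the same cohomology class if they differ by a coboundary, i.e. $g(u)-g'(u)=d_R(p)_\lambda(u)$ for all $u\in\mathcal{U}$, for some $p\in\mathcal{T}$. A linear deformation of $R$ is a sum $R_t=R+tR_1$ with $R_1\in\mathrm{Hom}(\mathcal{U},\mathcal{T})$ a $\mathbb{C}[\partial]$-linear map such that $R_t$ is a conformal $H$-twisted Rota-Baxter operator for all $t$. A morphism of conformal $H$-twisted Rota-Baxter operators from $R$ to $R'$ is a pair $(\phi,\psi)$ of an algebra morphism $\phi:\mathcal{T}\to\mathcal{T}$ and a linear map $\psi:\mathcal{U}\to\mathcal{U}$ with $\psi(q_\mu u)=\phi(q)_\mu\psi(u)$, $\psi(u_\mu q)=\psi(u)_\mu\phi(q)$, $\psi\circ H_\mu=H_\mu\circ(\phi\otimes\phi)$ and $\phi\circ R=R'\circ\psi$, for $q\in\mathcal{T}$, $u\in\mathcal{U}$. Two linear deformations $R_t=R+tR_1$ and $R'_t=R+tR'_1$ of $R$ are equivalent if there is $p\in\mathcal{T}$ such that the pair $$\phi_t=\mathrm{id}_{\mathcal{T}}+t(\mathrm{ad}^l_p-\mathrm{ad}^r_p),\qquad \psi_t=\mathrm{id}_{\mathcal{U}}+t\big(\mathfrak{l}_p-\mathfrak{r}_p+H_\lambda(p,R-)-H_\lambda(R-,p)\big)$$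 is a morphism of conformal $H$-twisted Rota-Baxter operators from $R_t$ to $R'_t$. Here $\mathrm{ad}^l_p(q)=p_\lambda q$, $\mathrm{ad}^r_p(q)=q_{-\partial-\lambda}p$, $\mathfrak{l}_p(u)=p_\lambda u$, $\mathfrak{r}_p(u)=u_{-\partial-\lambda}p$. In particular, the condition $\phi_t\circ R_t=R'_t\circ\psi_t$ reads, for all $u\in\mathcal{U}$, $$R_1(u)+p_\lambda R(u)-R(u)_{-\partial-\lambda}p=R\big(p_\lambda u-u_{-\partial-\lambda}p+H_\lambda(p,R(u))-H_\lambda(R(u),p)\big)+R'_1(u),$$ $$p_\lambda R_1(u)-R_1(u)_{-\partial-\lambda}p=R'_1\big(p_\lambda u-u_{-\partial-\lambda}p+H_\lambda(p,R(u))-H_\lambda(R(u),p)\big).$$ *)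

(* Defs.v *)
From HB Require Import structures.
From mathcomp Require Import all_boot all_order all_algebra.
From mathcomp Require Import boolp classical_sets functions reals complex.

Set Implicit Arguments.
Unset Strict Implicit.
Unset Printing Implicit Defensive.

Import GRing.Theory.
Local Open Scope ring_scope.

(* lpoly V is V[lambda], for a module V: a polynomial is its finitely supported
   family of coefficients, and the module structure is coefficientwise. It is
   iterated below: in lpoly (lpoly V), the inner variable is lambda and the
   outer one is mu. *)
Section ModulePolynomials.
Variables (K : comNzRingType) (V : lmodType K).

Definition finitely_supported : {pred nat -> V} :=
  fun f => `[< exists N, forall n, (N <= n)%N -> f n = 0 >].

Lemma finitely_supported_submod : submod_closed finitely_supported.
Proof.
split=> [|a f g /asboolP[N fN] /asboolP[M gM]]; apply/asboolP.
  by exists 0%N.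
exists (maxn N M) => n; rewrite geq_max => /andP[Nn Mn].
by change (a *: f n + g n = 0); rewrite fN // gM // scaler0 addr0.
Qed.

HB.instance Definition _ := GRing.isSubmodClosed.Build K (nat -> V)
  finitely_supported finitely_supported_submod.

Record lpoly := Lpoly {
  coefl :> nat -> V;
  coefl_fin : coefl \in finitely_supported }.

HB.instance Definition _ := [isSub for coefl].
HB.instance Definition _ := [Choice of lpoly by <:].
HB.instance Definition _ := [SubChoice_isSubLmodule of lpoly by <:].

Definition lbound (c : lpoly) : pred nat :=
  fun N => `[< forall n, (N <= n)%N -> c n = 0 >].

Lemma lbound_ex (c : lpoly) : exists N, lbound c N.
Proof.
by have /asboolP[N cN] := coefl_fin c; exists N; apply/asboolP.
Qed.

(* 1 + the degree, and 0 for the zero polynomial, as size on {poly K}. *)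
Definition lsize (c : lpoly) : nat := ex_minn (lbound_ex c).

Lemma lconst_fin (v : V) :
  (fun n : nat => if n is 0 then v else 0) \in finitely_supported.
Proof. by apply/asboolP; exists 1%N => -[]. Qed.

Definition lconst (v : V) : lpoly := Lpoly (lconst_fin v).

Lemma lmulX_fin (c : lpoly) :
  (fun n : nat => if n is m.+1 then c m else 0) \in finitely_supported.
Proof.
have /asboolP[N cN] := coefl_fin c.
by apply/asboolP; exists N.+1 => -[|n] //; apply: cN.
Qed.

(* Multiplication by the variable. *)
Definition lmulX (c : lpoly) : lpoly := Lpoly (lmulX_fin c).
End ModulePolynomials.

(* lsubst x f (\sum_n lambda^n c_n) = \sum_n x^n (f c_n): substitution of the
   operator x for the variable, the coefficients being moved to W along f. *)
Definition lsubst (K : comNzRingType) (V W : lmodType K)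
    (x : W -> W) (f : V -> W) (c : lpoly V) : W :=
  \sum_(n < lsize c) iter n x (f (c n)).

(* Coefficientwise application of f. *)
Definition lmap (K : comNzRingType) (V W : lmodType K) (f : V -> W) :
    lpoly V -> lpoly W :=
  lsubst (@lmulX K W) (fun v => lconst (f v)).

Section TwoVariables.
Variables (K : comNzRingType) (V : lmodType K).

Definition lam2 : lpoly (lpoly V) -> lpoly (lpoly V) := lmap (@lmulX K V).
Definition mu2 : lpoly (lpoly V) -> lpoly (lpoly V) := @lmulX K (lpoly V).
Definition lammu2 : lpoly (lpoly V) -> lpoly (lpoly V) := lam2 \+ mu2.
Definition lconst2 (v : V) : lpoly (lpoly V) := lconst (lconst v).
End TwoVariables.

Section Brackets.
Variable K : comNzRingType.
Implicit Types P Q S M N : lmodType K.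

(* p_{lambda} (q_{mu} r) *)
Definition nest_right P Q S M N (B1 : P -> N -> lpoly M) (B2 : Q -> S -> lpoly N)
    (p : P) (q : Q) (r : S) : lpoly (lpoly M) :=
  lsubst (@mu2 K M) (fun c => lsubst (@lam2 K M) (@lconst2 K M) (B1 p c))
    (B2 q r).

(* (p_{lambda} q)_{lambda + mu} r *)
Definition nest_left P Q S M N (B1 : N -> S -> lpoly M) (B2 : P -> Q -> lpoly N)
    (p : P) (q : Q) (r : S) : lpoly (lpoly M) :=
  lsubst (@lam2 K M) (fun c => lsubst (@lammu2 K M) (@lconst2 K M) (B1 c r))
    (B2 p q).

(* x_{mu} y for x and y depending polynomially on the parameter lambda, the
   bracket being extended linearly over the powers of lambda. *)
Definition param_bracket P Q M (B : P -> Q -> lpoly M)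
    (x : lpoly P) (y : lpoly Q) : lpoly (lpoly M) :=
  lsubst (@lam2 K M) (fun a =>
    lsubst (@lam2 K M) (fun b =>
      lsubst (@mu2 K M) (@lconst2 K M) (B a b)) y) x.
End Brackets.

Section Conformal.
Variable R : realType.

(* The complex numbers are R[i]. A C[partial]-module is an
   lmodType {poly R[i]}, with partial acting as 'X *: _ and a complex scalar a
   as a%:P *: _; the C[partial]-linear maps are {linear U -> T}. *)
Local Notation cdmod := (lmodType {poly R[i]}).

Definition complex_linear (V W : cdmod) (f : V -> W) : Prop :=
  forall (a : R[i]) (u v : V), f (a%:P *: u + v) = a%:P *: f u + f v.

Definition sesquilinear (P Q M : cdmod) (B : P -> Q -> lpoly M) : Prop :=
  [/\ forall q, complex_linear (B^~ q),
      forall p, complex_linear (B p),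
      forall p q, B ('X *: p) q = - lmulX (B p q) &
      forall p q, B p ('X *: q) = 'X *: B p q + lmulX (B p q)].

Record conformal_algebra := ConformalAlgebra {
  ca_sort :> cdmod;
  ca_mul : ca_sort -> ca_sort -> lpoly ca_sort;
  ca_sesqui : sesquilinear ca_mul;
  ca_assoc : forall p q r,
    nest_left ca_mul ca_mul p q r = nest_right ca_mul ca_mul p q r }.

Record conformal_bimodule (T : conformal_algebra) := ConformalBimodule {
  cb_sort :> cdmod;
  cb_l : T -> cb_sort -> lpoly cb_sort;
  cb_r : cb_sort -> T -> lpoly cb_sort;
  cb_l_sesqui : sesquilinear cb_l;
  cb_r_sesqui : sesquilinear cb_r;
  cb_lr : forall p u q, nest_left cb_r cb_l p u q = nest_right cb_l cb_r p u q;
  cb_rr : forall u p q,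
    nest_left cb_r cb_r u p q = nest_right cb_r (@ca_mul T) u p q;
  cb_ll : forall p q u,
    nest_left cb_l (@ca_mul T) p q u = nest_right cb_l cb_l p q u }.

Record hochschild_2cocycle (T : conformal_algebra) (U : conformal_bimodule T) :=
  Hochschild2Cocycle {
    hc_map :> T -> T -> lpoly U;
    hc_sesqui : sesquilinear hc_map;
    hc_cocycle : forall p1 p2 p3,
      nest_right (@cb_l T U) hc_map p1 p2 p3
      - nest_left hc_map (@ca_mul T) p1 p2 p3
      + nest_right hc_map (@ca_mul T) p1 p2 p3
      - nest_left (@cb_r T U) hc_map p1 p2 p3 = 0 }.

(* x_{- partial - lambda} y *)
Definition bracket_opp (P Q M : cdmod) (B : P -> Q -> lpoly M) (x : P) (y : Q) :
    lpoly M :=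
  lsubst (fun w : lpoly M => - ('X *: w) - lmulX w) (@lconst _ M) (B x y).

Section TwistedRotaBaxter.
Variables (T : conformal_algebra) (U : conformal_bimodule T).
Variable H : hochschild_2cocycle U.
Local Notation mul := (@ca_mul T).
Local Notation lact := (@cb_l T U).
Local Notation ract := (@cb_r T U).

Definition twisted_RB (Rop : {linear U -> T}) : Prop :=
  forall u v : U,
    mul (Rop u) (Rop v) =
    lmap Rop (ract u (Rop v) + lact (Rop u) v + H (Rop u) (Rop v)).

Definition cocycle1 (Rop g : {linear U -> T}) : Prop :=
  forall u v : U,
    mul (Rop u) (g v) + mul (g u) (Rop v) =
    lmap Rop (ract u (g v) + lact (g u) v + H (Rop u) (g v) + H (g u) (Rop v))
    + lmap g (ract u (Rop v) + lact (Rop u) v + H (Rop u) (Rop v)).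

(* ad^l_p - ad^r_p *)
Definition ad (p q : T) : lpoly T := mul p q - bracket_opp mul q p.

(* l_p - r_p + H_{lambda}(p, R -) - H_{lambda}(R -, p) *)
Definition twisted_ad (Rop : {linear U -> T}) (p : T) (u : U) : lpoly U :=
  lact p u - bracket_opp ract u p + H p (Rop u) - H (Rop u) p.

Definition coboundary (Rop : {linear U -> T}) (p : T) (u : U) : lpoly T :=
  lmap Rop (twisted_ad Rop p u) - ad p (Rop u).

(* Equality in T[lambda]: the left-hand side does not involve lambda. *)
Definition same_class (Rop g g' : {linear U -> T}) : Prop :=
  exists p : T, forall u : U, lconst (g u - g' u) = coboundary Rop p u.

Definition linear_deformation (Rop R1 : {linear U -> T}) : Prop :=
  forall t : R[i], twisted_RB (Rop \+ t%:P \*: R1).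

(* phi and psi depend polynomially on the parameter lambda, and so do all the
   conditions; the bracket variable is mu. They are C-linear only, since
   ad p is not C[partial]-linear. *)
Definition RB_morphism (Rop Rop' : {linear U -> T})
    (phi : T -> lpoly T) (psi : U -> lpoly U) : Prop :=
  complex_linear phi /\ complex_linear psi /\
  (forall q r, lmap phi (mul q r) = param_bracket mul (phi q) (phi r)) /\
  (forall q u, lmap psi (lact q u) = param_bracket lact (phi q) (psi u)) /\
  (forall u q, lmap psi (ract u q) = param_bracket ract (psi u) (phi q)) /\
  (forall q r, lmap psi (H q r) = param_bracket H (phi q) (phi r)) /\
  (forall u, phi (Rop u) = lmap Rop' (psi u)).

Definition equivalent_deformations (Rop R1 R1' : {linear U -> T}) : Prop :=
  exists p : T, forall t : R[i],
    RB_morphism (Rop \+ t%:P \*: R1) (Rop \+ t%:P \*: R1')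
      (fun q => lconst q + t%:P *: ad p q)
      (fun u => lconst u + t%:P *: twisted_ad Rop p u).
End TwistedRotaBaxter.
End Conformal.

(* Main.v *)
(* Both conclusions are the coefficient of t in an identity that is polynomial
   in t: the Rota-Baxter identity of R + t R_1, which is cubic, and the
   condition phi_t o R_t = R'_t o psi_t, which is quadratic. *)
Require Import Defs.
From mathcomp Require Import all_boot all_order all_algebra.
From mathcomp Require Import reals complex.
From mathcomp Require Import boolp ring.

Import GRing.Theory.

Local Open Scope ring_scope.

(** * Coefficientwise maps on module polynomials *)

Section LmapTheory.
Set Implicit Arguments.
Unset Strict Implicit.
Variable K : comNzRingType.
Implicit Types V W : lmodType K.

Lemma lpolyP V (c d : lpoly V) : (forall n, c n = d n) <-> c = d.
Proof. by split=> [cd|-> //]; apply: val_inj; apply: funext. Qed.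

Lemma coeflD V (c d : lpoly V) n : (c + d) n = c n + d n. Proof. by []. Qed.

Lemma coeflZ V a (c : lpoly V) n : (a *: c) n = a *: c n. Proof. by []. Qed.

Lemma coefl_lconst V (v : V) n : lconst v n = if n is 0 then v else 0.
Proof. by []. Qed.

Lemma coefl_sum V (N : nat) (F : 'I_N -> lpoly V) n :
  (\sum_i F i) n = \sum_i F i n.
Proof. exact: (big_morph (fun c : lpoly V => c n) (fun c d => coeflD c d n)). Qed.

Lemma coefl_iter_lmulX V (v : V) k n :
  iter k (@lmulX K V) (lconst v) n = if n == k then v else 0.
Proof. by elim: k n => [|k IH] [|n] //=; rewrite IH. Qed.

Lemma coefl_ge_lsize V (c : lpoly V) n : (lsize c <= n)%N -> c n = 0.
Proof. by rewrite /lsize; case: ex_minnP => N /asboolP cN _; apply: cN. Qed.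

(** [lmap] is defined as a sum of monomials cut off at [lsize c]. Beyond the cutoff both sides
    vanish because [f 0 = 0]. From here on, identities about [lmap] are checked one coefficient at a
    time. *)
Lemma coefl_lmap V W (f : {linear V -> W}) (c : lpoly V) n :
  lmap f c n = f (c n).
Proof.
rewrite /lmap /lsubst coefl_sum.
under eq_bigr => i _ do rewrite coefl_iter_lmulX.
have [nc|cn] := ltnP n (lsize c); last first.
  rewrite coefl_ge_lsize // linear0 big1 // => i _.
  by rewrite gtn_eqF // (leq_trans (ltn_ord i)).
rewrite (bigD1 (Ordinal nc)) //= eqxx big1 ?addr0 // => i ni.
by rewrite ifN // eq_sym.
Qed.

Lemma lmapD V W (f : {linear V -> W}) c d :
  lmap f (c + d) = lmap f c + lmap f d.
Proof. by apply/lpolyP => n; rewrite !(coeflD, coefl_lmap) linearD. Qed.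

Lemma lmapZ V W (f : {linear V -> W}) a c : lmap f (a *: c) = a *: lmap f c.
Proof. by apply/lpolyP => n; rewrite !(coeflZ, coefl_lmap) linearZ. Qed.

Lemma lmap_lconst V W (f : {linear V -> W}) v :
  lmap f (lconst v) = lconst (f v).
Proof.
by apply/lpolyP => n; rewrite coefl_lmap !coefl_lconst; case: n; rewrite ?linear0.
Qed.

Lemma lmap_addZ V W (f g : {linear V -> W}) a c :
  lmap (f \+ a \*: g) c = lmap f c + a *: lmap g c.
Proof. by apply/lpolyP => n; rewrite coeflD coeflZ !coefl_lmap. Qed.

(** With [f + t g] a deformed operator and its argument quadratic in [t], this sorts the right-hand
    sides of both deformation identities by powers of [t]. *)
Lemma lmap_addZ_quadratic V W (f g : {linear V -> W}) t c0 c1 c2 :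
  lmap (f \+ t \*: g) (c0 + t *: c1 + t ^+ 2 *: c2) =
  lmap f c0 + t *: (lmap f c1 + lmap g c0)
  + t ^+ 2 *: (lmap f c2 + lmap g c1) + t ^+ 3 *: lmap g c2.
Proof.
rewrite lmap_addZ !lmapD !lmapZ !scalerDr !scalerA -expr2 -exprS !addrA.
by congr (_ + _); rewrite -[LHS]addrA addrACA !addrA.
Qed.

Lemma lconstD V (u v : V) : lconst (u + v) = lconst u + lconst v.
Proof. by apply/lpolyP => -[|n]; rewrite coeflD !coefl_lconst ?addr0. Qed.

Lemma lconstZ V a (v : V) : lconst (a *: v) = a *: lconst v.
Proof. by apply/lpolyP => -[|n]; rewrite coeflZ !coefl_lconst ?scaler0. Qed.

Lemma lconstB V (u v : V) : lconst (u - v) = lconst u - lconst v.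
Proof. by rewrite -scaleN1r lconstD lconstZ scaleN1r. Qed.

End LmapTheory.

(* With P t the difference of the two sides, 12 (B - B') is
   8 (P 1 - P (-1)) - (P 2 - P (-2)). *)
Lemma cubic_eq_coef1 (F : numFieldType) (V : lmodType {poly F})
    (A B C D B' C' D' : V) :
  (forall t : F,
    A + t%:P *: B + (t ^+ 2)%:P *: C + (t ^+ 3)%:P *: D =
    A + t%:P *: B' + (t ^+ 2)%:P *: C' + (t ^+ 3)%:P *: D') ->
  B = B'.
Proof.
move=> tE; apply/eqP; rewrite -subr_eq0; apply/eqP.
(* Recording combinations of the three differences by their coefficients in [F] turns the
   elimination into scalar identities that [ring] can close. *)
pose lin (b c d : F) := b%:P *: (B - B') + c%:P *: (C - C') + d%:P *: (D - D').
have linD b c d b' c' d' :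
    lin b c d + lin b' c' d' = lin (b + b') (c + c') (d + d').
  by rewrite /lin !polyCD !scalerDl [LHS]addrACA; congr (_ + _); rewrite addrACA.
have linZ a b c d : a%:P *: lin b c d = lin (a * b) (a * c) (a * d).
  by rewrite /lin !scalerDr !scalerA -!polyCM.
have lin0 t : lin t (t ^+ 2) (t ^+ 3) = 0.
  rewrite /lin !scalerBr; move/eqP: (tE t); rewrite -subr_eq0 !opprD => /eqP.
  rewrite [LHS]addrACA [X in X + _]addrACA [X in X + _ + _]addrACA.
  by rewrite subrr add0r.
have lin12 : lin 12 0 0 = 0.
  (* The differences at opposite points kill the even term; the weight 8 = 2 ^ 3 then cancels the
     cubic term and leaves 16 - 4 = 12. *)
  have -> : lin 12 0 0 =
      8%:P *: lin 1 (1 ^+ 2) (1 ^+ 3) + (- 8)%:P *: lin (-1) ((-1) ^+ 2) ((-1) ^+ 3)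
      + ((-1)%:P *: lin 2 (2 ^+ 2) (2 ^+ 3)
         + lin (-2) ((-2) ^+ 2) ((-2) ^+ 3)).
    by rewrite !linZ !linD; congr lin; ring.
  by rewrite !lin0 !scaler0 !addr0.
have -> : B - B' = (12^-1)%:P *: lin 12 0 0.
  rewrite linZ mulVf ?Num.Theory.pnatr_eq0 // !mulr0.
  by rewrite /lin scale1r !scale0r !addr0.
by rewrite lin12 scaler0.
Qed.

(** * Expansion of sesquilinear maps in a complex parameter *)

Section ComplexLinear.
Set Implicit Arguments.
Unset Strict Implicit.
Variable R : realType.
Implicit Types P Q M : lmodType {poly R[i]}.

Lemma complex_linear_addZ P Q (f : P -> Q) : complex_linear f ->
  forall (a : R[i]) u v, f (u + a%:P *: v) = f u + a%:P *: f v.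
Proof. by move=> f_lin a u v; rewrite addrC f_lin addrC. Qed.

Section Sesquilinear.
Variables (P Q M : lmodType {poly R[i]}) (B : P -> Q -> lpoly M).
Hypothesis B_sesqui : sesquilinear B.

Lemma sesquilinear_addZl (a : R[i]) p p' q :
  B (p + a%:P *: p') q = B p q + a%:P *: B p' q.
Proof. by case: B_sesqui => Bl _ _ _; apply: (complex_linear_addZ (Bl q)). Qed.

Lemma sesquilinear_addZr (a : R[i]) p q q' :
  B p (q + a%:P *: q') = B p q + a%:P *: B p q'.
Proof. by case: B_sesqui => _ Br _ _; apply: (complex_linear_addZ (Br p)). Qed.

Lemma sesquilinear_addZ (a : R[i]) p p' q q' :
  B (p + a%:P *: p') (q + a%:P *: q') =
  B p q + a%:P *: (B p q' + B p' q) + (a ^+ 2)%:P *: B p' q'.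
Proof.
rewrite sesquilinear_addZl !sesquilinear_addZr !scalerDr scalerA -polyCM -expr2.
by rewrite !addrA.
Qed.

End Sesquilinear.

End ComplexLinear.

(** * First-order terms of deformations and of their equivalences *)

Section LinearDeformations.
Variables (R : realType) (T : conformal_algebra R) (U : conformal_bimodule T).
Variables (H : hochschild_2cocycle U) (Rop : {linear U -> T}).

Lemma linear_deformation_cocycle1 (R1 : {linear U -> T}) :
  twisted_RB H Rop -> linear_deformation H Rop R1 -> cocycle1 H Rop R1.
Proof.
move=> RB0 RBt u v.
(* [S0], [S1], [S2] are the coefficients of 1, [t], [t ^+ 2] in the argument of the deformed
   operator; the quadratic one comes from [H] alone, the actions being affine in [t]. *)
pose S0 := cb_r u (Rop v) + cb_l (Rop u) v + H (Rop u) (Rop v).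
pose S1 := cb_r u (R1 v) + cb_l (R1 u) v + H (Rop u) (R1 v) + H (R1 u) (Rop v).
pose S2 := H (R1 u) (R1 v).
(* The product side has no cubic term, hence the 0. The constant terms agree by the identity for
   [Rop] itself. *)
apply: (@cubic_eq_coef1 _ _ (ca_mul (Rop u) (Rop v)) _
  (ca_mul (R1 u) (R1 v)) 0 _ (lmap Rop S2 + lmap R1 S1) (lmap R1 S2)) => t.
have := RBt t u v.
rewrite /= !(sesquilinear_addZ (ca_sesqui T)) (sesquilinear_addZ (hc_sesqui H)).
rewrite (sesquilinear_addZr (cb_r_sesqui U)) (sesquilinear_addZl (cb_l_sesqui U)).
set c := (X in lmap _ X).
have -> : c = S0 + t%:P *: S1 + (t ^+ 2)%:P *: S2.
  rewrite /c /S0 /S1 /S2 !scalerDr !addrA; congr (_ + _).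
  rewrite -!addrA; congr (_ + _).
  rewrite (addrCA (t%:P *: _) (cb_l _ _)); congr (_ + _).
  rewrite (addrCA (t%:P *: cb_l _ _) (H _ _)).
  by rewrite (addrCA (t%:P *: cb_r _ _) (H _ _)).
rewrite scaler0 addr0 => ->; rewrite -/S0 -/S1 RB0 -/S0 !polyC_exp.
exact: lmap_addZ_quadratic.
Qed.

Lemma equivalent_deformations_same_class (R1 R1' : {linear U -> T}) :
  equivalent_deformations H Rop R1 R1' -> same_class H Rop R1 R1'.
Proof.
case=> p equiv; exists p => u.
(* At [t = 1] the map [phi] is the inclusion of constants plus [ad p], so subtracting the inclusion
   leaves a complex linear map. *)
have ad_lin : complex_linear (ad p).
  have [phi_lin _] := equiv 1 => a q r.
  apply: (addrI (lconst (a%:P *: q + r))).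
  have := phi_lin a q r; rewrite !scale1r => ->.
  by rewrite scalerDr lconstD lconstZ addrACA.
have mor t : lconst (Rop u + t%:P *: R1 u)
      + t%:P *: (ad p (Rop u) + t%:P *: ad p (R1 u)) =
    lmap (Rop \+ t%:P \*: R1') (lconst u + t%:P *: twisted_ad H Rop p u).
  have [_ [_ [_ [_ [_ [_ <-]]]]]] := equiv t.
  by rewrite /= (complex_linear_addZ ad_lin).
have lmap0 (f : {linear U -> T}) : lmap f 0 = 0.
  by rewrite -(scale0r 0) lmapZ scale0r.
(* The coefficient of [t] in [mor]. Since [psi] is affine in [t], the quadratic expansion is used
   with [c2 = 0], and both cubic terms vanish. Rearranged, [e] is the coboundary equation for the
   same [p]. *)
have e : ad p (Rop u) + lconst (R1 u) =
    lmap Rop (twisted_ad H Rop p u) + lconst (R1' u).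
  apply: (@cubic_eq_coef1 _ _ (lconst (Rop u)) _
    (ad p (R1 u)) 0 _ (lmap R1' (twisted_ad H Rop p u)) 0) => t.
  have := lmap_addZ_quadratic Rop R1' t%:P (lconst u) (twisted_ad H Rop p u) 0.
  rewrite !scaler0 !addr0 -mor !lmap0 add0r scaler0 addr0 !lmap_lconst => adE.
  rewrite !polyC_exp -adE lconstD lconstZ (scalerDr _ (ad p (Rop u)) (lconst _)).
  by rewrite (scalerDr _ (ad p (Rop u)) (_ *: _)) scalerA addrACA -!addrA.
by rewrite lconstB /coboundary; apply/eqP; rewrite subr_eq addrAC -e [X in X - _]addrC addrK.
Qed.

End LinearDeformations.

Theorem theorem4p3 (R : realType) (T : conformal_algebra R)
    (U : conformal_bimodule T) (H : hochschild_2cocycle U)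
    (Rop : {linear U -> T}) (hRop : twisted_RB H Rop)
    (R1 : {linear U -> T}) (hR1 : linear_deformation H Rop R1) :
  cocycle1 H Rop R1 /\
  (forall R1' : {linear U -> T},
    linear_deformation H Rop R1' ->
    equivalent_deformations H Rop R1 R1' ->
    same_class H Rop R1 R1').
Proof.
split; first exact: linear_deformation_cocycle1.
by move=> R1' _; apply: equivalent_deformations_same_class.
Qed.
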